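(* Let $r \ge t \ge 1$ be fixed integers. Then $$p(n, r, t) = (1 + o(1))\, d(n, r, t) \quad \text{as } n \to \infty.$$
   Context: $[n] = \{1, \ldots, n\}$ and $[n]^{(r)}$ is the collection of all $r$-element subsets of $[n]$. A pair $(\mathcal{A}, \mathcal{B})$ of set systems is $t$-cross-avoiding if $|A \cap B| \ne t$ for all $A \in \mathcal{A}$, $B \in \mathcal{B}$. $d(\mathcal{A}, \mathcal{B})$ is the number of pairs $(A,B) \in \mathcal{A} \times \mathcal{B}$ with $A \cap B = \varnothing$. Define $$d(n,r,t) = \max\{ d(\mathcal{A}, \mathcal{B}) : \mathcal{A}, \mathcal{B} \subseteq [n]^{(r)},\ (\mathcal{A}, \mathcal{B}) \text{ is } t\text{-cross-avoiding}\},$$ $$p(n,r,t) = \max\{ |\mathcal{A}||\mathcal{B}| : \mathcal{A}, \mathcal{B} \subseteq [n]^{(r)},\ (\mathcal{A}, \mathcal{B}) \text{ is } t\text{-cross-avoiding}\}.$$ The $o(1)$ term is for $r, t$ fixed and $n \to \infty$. *)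

(* Defs.v *)
From mathcomp Require Import all_boot.

Set Implicit Arguments.
Unset Strict Implicit.
Unset Printing Implicit Defensive.

(* The ground set [n] is represented by 'I_n = {0, ..., n-1}. *)
Definition rsubsets (n r : nat) : {set {set 'I_n}} :=
  [set A : {set 'I_n} | #|A| == r].

Definition cross_avoiding (T : finType) (t : nat) (A B : {set {set T}}) : bool :=
  [forall X in A, forall Y in B, #|X :&: Y| != t].

Definition disjoint_pairs (T : finType) (A B : {set {set T}}) : nat :=
  #|[set XY in setX A B | XY.1 :&: XY.2 == set0]|.

Definition admissible (n r t : nat)
    (AB : {set {set 'I_n}} * {set {set 'I_n}}) : bool :=
  [&& AB.1 \subset rsubsets n r, AB.2 \subset rsubsets n r &
      cross_avoiding t AB.1 AB.2].

(* The maxima range over a nonempty set of pairs, since (set0, set0) is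
   admissible, so the default value 0 of \max plays no role. *)
Definition max_disjoint_pairs (n r t : nat) : nat :=
  \max_(AB : {set {set 'I_n}} * {set {set 'I_n}} | admissible r t AB)
    disjoint_pairs AB.1 AB.2.

Definition max_card_product (n r t : nat) : nat :=
  \max_(AB : {set {set 'I_n}} * {set {set 'I_n}} | admissible r t AB)
    (#|AB.1| * #|AB.2|)%N.

(* Main.v *)
Require Import Defs.
From mathcomp Require Import all_boot all_order all_algebra.
From mathcomp Require Import all_classical all_reals all_analysis.
From mathcomp Require Import zify.
Import Order.TTheory GRing.Theory Num.Theory.
Import numFieldNormedType.Exports.

(** Almost all pairs of [r]-sets are disjoint, so a [t]-cross-avoiding pair of
    families whose product of sizes is of the order of [n ^ (2 * r)] loses only
    a vanishing proportion of its pairs when the intersecting ones are dropped.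

    The pairs of [r]-sets with a common point number at most
    [n * (n ^ r.-1) ^ 2], since a common point can be chosen in [n] ways and
    each of the two sets is then determined by [r.-1] further points. Hence
    the product of sizes exceeds the number of disjoint pairs by at most this
    quantity ([max_card_product_leq]), which has order [n ^ (2 * r - 1)].

    On the other hand, as [t > 0], the families of all [r]-subsets of two
    complementary halves of the ground set are [t]-cross-avoiding and all their
    pairs are disjoint. This gives at least ['C(n./2, r) ^ 2] disjoint pairs
    ([max_disjoint_pairs_geq]), which has order [n ^ (2 * r)]. The relative
    error is therefore at most a constant over [n] ([max_card_product_gap]). *)

Section SetFamilies.

(* Makes the names shared with classical sets refer to finite sets. *)
Import mathcomp.boot.fintype mathcomp.boot.finset.

Lemma ffact_leq_exp n k : n ^_ k <= n ^ k.
Proof.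
elim: k => [|k IHk]; first by rewrite ffactn0.
by rewrite ffactnSr expnSr leq_mul // leq_subr.
Qed.

Lemma exp_subn_leq_ffact n k : (n - k) ^ k <= n ^_ k.
Proof.
elim: k => [|k IHk]; first by rewrite ffactn0.
have le_sub : n - k.+1 <= n - k by rewrite leq_sub2l.
rewrite ffactnSr expnSr leq_mul // (leq_trans _ IHk) //.
by case: k le_sub {IHk} => // k le_sub; rewrite leq_exp2r.
Qed.

Lemma bin_leq_exp n k : 'C(n, k) <= n ^ k.
Proof.
apply: leq_trans (ffact_leq_exp n k).
by rewrite -bin_ffact leq_pmulr // fact_gt0.
Qed.

(** Removing [x] maps these sets injectively to [r.-1]-subsets. *)
Lemma card_uniform_star n r x (F : {set {set 'I_n}}) :
  F \subset rsubsets n r -> #|[set X in F | x \in X]| <= n ^ r.-1.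
Proof.
move=> /subsetP Fr.
apply: leq_trans (bin_leq_exp n r.-1).
rewrite -[X in 'C(X, _)]card_ord -card_draws.
rewrite -(@card_in_imset _ _ (fun X => X :\ x)).
  apply/subset_leq_card/subsetP => _ /imsetP[X + ->].
  rewrite !inE => /andP[/Fr + xX].
  by rewrite inE (cardsD1 x) xX add1n => /eqP <-.
move=> X Y; rewrite !inE => /andP[_ xX] /andP[_ xY] eqXY.
by rewrite -(setD1K xX) eqXY setD1K.
Qed.

(** The sum counts each intersecting pair once for every common point, hence
    at least once. *)
Lemma card_setX_leq_disjoint (T : finType) (F G : {set {set T}}) :
  #|F| * #|G| <= disjoint_pairs F G +
    \sum_x #|[set X in F | x \in X]| * #|[set Y in G | x \in Y]|.
Proof.
rewrite -cardsX.
pose star x := setX [set X in F | x \in X] [set Y in G | x \in Y].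
have subU : setX F G \subset
    [set XY in setX F G | XY.1 :&: XY.2 == set0] :|: \bigcup_x star x.
  apply/subsetP => -[X Y] /setXP[XF YG]; rewrite !inE /= XF YG /=.
  have [//|[x]] := set_0Vmem (X :&: Y); first by move=> ->; rewrite eqxx.
  rewrite inE => /andP[xX xY]; apply/orP; right; apply/bigcupP; exists x => //.
  by rewrite !inE /= XF YG xX xY.
apply: leq_trans (subset_leq_card subU) _.
apply: leq_trans (leq_card_setU _ _) _.
rewrite leq_add2l.
elim/big_ind2: _ => [|A m B p leAm leBp|x _]; first by rewrite cards0.
  exact: leq_trans (leq_card_setU _ _) (leq_add leAm leBp).
by rewrite cardsX.
Qed.

Lemma disjoint_pairs_setX (T : finType) (F G : {set {set T}}) :
  {in F & G, forall X Y, X :&: Y = set0} -> disjoint_pairs F G = #|F| * #|G|.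
Proof.
move=> FG0; rewrite -cardsX /disjoint_pairs; congr #|pred_of_set _|.
apply/setP => -[X Y]; rewrite !inE /=.
case: (boolP (X \in F)) => // XF; case: (boolP (Y \in G)) => // YG.
by rewrite FG0 ?eqxx.
Qed.

Lemma half_split n : exists L : {set 'I_n}, n./2 <= #|L| /\ n./2 <= #|~: L|.
Proof.
have le_n : n./2 <= n by lia.
pose L := [set widen_ord le_n i | i : 'I_n./2]; exists L.
have cardL : #|L| = n./2.
  by rewrite card_imset ?card_ord // => i j /(congr1 val) /= /val_inj.
have := cardsC L; rewrite card_ord cardL => cardLC.
by split=> //; rewrite -(leq_add2l n./2) cardLC; lia.
Qed.

Lemma disjoint_pairs_leq_max n r t (AB : {set {set 'I_n}} * {set {set 'I_n}}) :
  admissible r t AB -> disjoint_pairs AB.1 AB.2 <= max_disjoint_pairs n r t.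
Proof. by move=> admAB; rewrite /max_disjoint_pairs (bigop.bigmax_sup AB). Qed.

Lemma card_product_leq_max n r t (AB : {set {set 'I_n}} * {set {set 'I_n}}) :
  admissible r t AB -> #|AB.1| * #|AB.2| <= max_card_product n r t.
Proof. by move=> admAB; rewrite /max_card_product (bigop.bigmax_sup AB). Qed.

(** Witnessed by the families of [r]-subsets of the two parts of a balanced
    bipartition: sets on opposite sides meet in [0] points, and [0 <> t]. *)
Lemma max_disjoint_pairs_geq n r t :
  0 < t -> 'C(n./2, r) ^ 2 <= max_disjoint_pairs n r t.
Proof.
move=> t_gt0; have [L [leL leLC]] := half_split n.
pose F (S : {set 'I_n}) := [set X : {set 'I_n} | X \subset S & #|X| == r].
have FL0 : {in F L & F (~: L), forall X Y, X :&: Y = set0}.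
  move=> X Y; rewrite !inE => /andP[XL _] /andP[YL _].
  apply/eqP; rewrite setI_eq0; apply: disjointWl XL _.
  by rewrite disjoints_subset -setCS setCK.
have Fr S : F S \subset rsubsets n r.
  by apply/subsetP => X; rewrite !inE => /andP[].
have adm : admissible r t (F L, F (~: L)).
  rewrite /admissible !Fr /=.
  apply/'forall_implyP => X XL; apply/'forall_implyP => Y YL.
  by rewrite FL0 // cards0 eq_sym -lt0n.
apply: leq_trans (disjoint_pairs_leq_max _ _ _ _ adm).
by rewrite /= disjoint_pairs_setX // !cards_draws leq_mul ?leq_bin2l.
Qed.

Lemma max_disjoint_pairs_leq_card_product n r t :
  max_disjoint_pairs n r t <= max_card_product n r t.
Proof.
apply/bigop.bigmax_leqP => AB admAB.
apply: leq_trans (card_product_leq_max _ _ _ _ admAB).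
rewrite -cardsX /disjoint_pairs setIdE; exact: subset_leq_card (subsetIl _ _).
Qed.

Lemma max_card_product_leq n r t :
  max_card_product n r t <= max_disjoint_pairs n r t + n * (n ^ r.-1) ^ 2.
Proof.
apply/bigop.bigmax_leqP => AB admAB; have /and3P[Ar Br _] := admAB.
apply: leq_trans (card_setX_leq_disjoint _ _ _) _.
apply: leq_add; first exact: disjoint_pairs_leq_max _ _ _ _ admAB.
rewrite -[X in _ <= X * _]card_ord -sum_nat_const.
by apply: leq_sum => x _; rewrite leq_mul ?card_uniform_star.
Qed.

(** For [r >= 1] and [n >= 8 * r], each of the [r] factors of the falling
    factorial of [n./2] is at least [n./2 - r >= n / 8]. *)
Lemma exp_leq_bin_half n r :
  0 < r -> 8 * r <= n -> n ^ r <= 8 ^ r * r`! * 'C(n./2, r).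
Proof.
move=> r_gt0 le_rn; rewrite -mulnA [r`! * _]mulnC bin_ffact.
apply: leq_trans (leq_mul (leqnn _) (exp_subn_leq_ffact n./2 r)).
by rewrite -expnMn leq_exp2r //; lia.
Qed.

(** The quantitative form of the theorem, free of division: a gap of order
    [n ^ (2 * r - 1)] is compared with a maximum of order [n ^ (2 * r)]. *)
Lemma max_card_product_gap n r t : 0 < t -> 0 < r -> 8 * r <= n ->
  n * (max_card_product n r t - max_disjoint_pairs n r t)
    <= (8 ^ r * r`!) ^ 2 * max_disjoint_pairs n r t.
Proof.
move=> t_gt0 r_gt0 le_rn.
apply: leq_trans (leq_mul (leqnn _) (max_disjoint_pairs_geq n r t t_gt0)).
apply: (@leq_trans ((n ^ r) ^ 2)); last first.
  by rewrite -expnMn leq_exp2r // exp_leq_bin_half.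
rewrite -[in X in _ <= X](prednK r_gt0) (expnS n) expnMn -mulnn -mulnA leq_mul //.
by rewrite leq_subLR max_card_product_leq.
Qed.

End SetFamilies.

Local Open Scope classical_set_scope.
Local Open Scope ring_scope.

Theorem theorem1p5 (R : realType) (r t : nat)
    (t_ge1 : (1 <= t)%N) (t_le_r : (t <= r)%N) :
  exists2 e : nat -> R,
    e n @[n --> \oo] --> (0 : R) &
    \forall n \near \oo,
      (max_card_product n r t)%:R = (1 + e n) * (max_disjoint_pairs n r t)%:R.
Proof.
have r_gt0 : (0 < r)%N := leq_trans t_ge1 t_le_r.
pose p n : R := (max_card_product n r t)%:R.
pose d n : R := (max_disjoint_pairs n r t)%:R.
pose K : R := ((8 ^ r * r`!) ^ 2)%:R.
have d_gt0 n : (8 * r <= n)%N -> 0 < d n.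
  move=> le_rn; rewrite ltr0n.
  apply: leq_trans (max_disjoint_pairs_geq n r t t_ge1).
  by rewrite expn_gt0 bin_gt0; apply/orP; left; lia.
have gap n : (8 * r <= n)%N -> n%:R * (p n - d n) <= K * d n.
  move=> le_rn; rewrite -natrB ?max_disjoint_pairs_leq_card_product //.
  rewrite -!natrM ler_nat.
  exact: max_card_product_gap.
exists (fun n => p n / d n - 1); last first.
  near=> n; rewrite addrC subrK divfK // gt_eqF // d_gt0 //.
  by near: n; exact: nbhs_infty_ge.
apply: (@squeeze_cvgr _ _ _ _ (fun=> 0) (fun n => K * n%:R^-1)).
- near=> n.
  have le_rn : (8 * r <= n)%N by near: n; exact: nbhs_infty_ge.
  have n_gt0 : 0 < n%:R :> R by rewrite ltr0n; lia.
  have dn_gt0 := d_gt0 n le_rn.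
  rewrite subr_ge0 ler_pdivlMr // mul1r ler_nat.
  rewrite max_disjoint_pairs_leq_card_product /=.
  rewrite -[X in _ - X](divff (lt0r_neq0 dn_gt0)) -mulrBl ler_pdivrMr //.
  by rewrite mulrAC ler_pdivlMr // mulrC gap.
- exact: cvg_cst.
- rewrite -[X in _ --> X](mulr0 K); apply: cvgM; first exact: cvg_cst.
  apply/gtr0_cvgV0; last exact: cvgr_idn.
  by near=> n; rewrite ltr0n; near: n; exact: nbhs_infty_gt.
Unshelve. all: by end_near. Qed.
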